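(* Let $N$ be a positive even integer and $d>0$, and let $B(0),B_1,B_2(0),\widehat P\in\mathbb R^{2N\times 2N}$ and the real coefficients $\zeta_{j,N}$ $(0\le j\le 2N-1)$, $\eta_{j,N}$ $(1\le j\le 2N-1)$ be as defined in the context. Then $$\left[B(0)+\frac dN B_1\right]^{2N}=I_{2N}+\frac{2d}N\widehat P+\sum_{j=0}^{2N-1}\zeta_{j,N}B(0)^{2j}B_2(0)+\sum_{j=1}^{2N-1}\eta_{j,N}B(0)^{2j},$$ where $$0\le\sum_{j=0}^{2N-1}\zeta_{j,N}\le\sinh(2d)-2d+\frac1Nf_0(d),\qquad 0\le\sum_{j=1}^{2N-1}\eta_{j,N}\le\cosh(2d)-1+\frac1Nf_1(d),$$ and $$f_0(d)=\sum_{\ell=1}^\infty\frac{d^{2\ell+1}}{(\ell!)^2}=d\,[I_0(2d)-1],\qquad f_1(d)=\sum_{h=1}^\infty\frac{d^{2h}}{h!\,(h-1)!}=d\,I_1(2d),$$ with $I_\alpha(2x)=\sum_{m=0}^\infty\frac{x^{2m+\alpha}}{m!\,(m+\alpha)!}$, $\alpha=0,1$, the modified Bessel functions of the first type.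
   Context: $B_1\in\mathbb R^{2N\times2N}$ is the block-diagonal permutation matrix with $N$ diagonal blocks $\begin{pmatrix}0&1\\1&0\end{pmatrix}$ (it swaps the coordinates $2i-1$ and $2i$, $i=1,\dots,N$). $B_2(0)\in\mathbb R^{2N\times2N}$ is the block-diagonal permutation matrix with diagonal blocks $1$, then $N-1$ copies of $\begin{pmatrix}0&1\\1&0\end{pmatrix}$, then $1$ (it fixes coordinates $1$ and $2N$ and swaps $2j$ and $2j+1$, $j=1,\dots,N-1$). $B(0)=B_2(0)B_1$. $e=(1,\dots,1)^t\in\mathbb R^{2N}$, $v_-=(1,-1,-1,1,1,-1,-1,1,\dots,1,-1,-1,1)^t\in\mathbb R^{2N}$ (the pattern $1,-1,-1,1$ repeated $N/2$ times), and $\widehat P=\frac12(ee^t+v_-v_-^t)$. With $\gamma=d/N$, $$\zeta_{j,N}=\sum_{\ell=1}^{\min\{j,2N-j-1\}}\gamma^{2\ell+1}\binom j\ell\binom{2N-j-1}\ell,\qquad \eta_{j,N}=\sum_{h=1}^{\min\{j,2N-j\}}\gamma^{2h}\binom jh\binom{2N-j-1}{h-1}$$ (empty sums being $0$). $I_{2N}$ is the identity matrix. *)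

(* Defs.v *)
From mathcomp Require Import all_boot all_order all_algebra.
From mathcomp Require Import all_classical all_reals all_analysis.

Set Implicit Arguments.
Unset Strict Implicit.
Unset Printing Implicit Defensive.

Import Order.TTheory GRing.Theory Num.Theory.
Import numFieldNormedType.Exports.

Local Open Scope ring_scope.

(* Coordinates are indexed from 0, so the coordinate 2i-1 of the mathematical
   text is the index 2i-2 : a pair of coordinates (2i-1, 2i) is a pair of
   indices (even, odd). *)

Definition swap1 (i : nat) : nat := if odd i then i.-1 else i.+1.

Definition swap2 (N i : nat) : nat :=
  if (i == 0)%N || (i == (2 * N).-1)%N then i
  else if odd i then i.+1 else i.-1.

Definition B1 (R : realType) (N : nat) : 'M[R]_(2 * N) :=
  \matrix_(i, j) (j == swap1 i :> nat)%:R.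

Definition B2 (R : realType) (N : nat) : 'M[R]_(2 * N) :=
  \matrix_(i, j) (j == swap2 N i :> nat)%:R.

Definition B (R : realType) (N : nat) : 'M[R]_(2 * N) := B2 R N *m B1 R N.

Definition evec (R : realType) (N : nat) : 'cV[R]_(2 * N) := const_mx 1.

Definition vminus (R : realType) (N : nat) : 'cV[R]_(2 * N) :=
  \col_i (if ((i %% 4 == 0) || (i %% 4 == 3))%N then 1 else -1).

Definition Phat (R : realType) (N : nat) : 'M[R]_(2 * N) :=
  2^-1 *: (evec R N *m (evec R N)^T + vminus R N *m (vminus R N)^T).

(* The subtractions on nat below are never truncated for 0 <= j < 2N and
   1 <= h, the only values that are used. *)

Definition zeta (R : realType) (N : nat) (d : R) (j : nat) : R :=
  \sum_(1 <= l < (minn j (2 * N - j - 1)).+1)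
    (d / N%:R) ^+ (2 * l + 1) * 'C(j, l)%:R * 'C(2 * N - j - 1, l)%:R.

Definition eta (R : realType) (N : nat) (d : R) (j : nat) : R :=
  \sum_(1 <= h < (minn j (2 * N - j)).+1)
    (d / N%:R) ^+ (2 * h) * 'C(j, h)%:R * 'C(2 * N - j - 1, h - 1)%:R.

Definition sinh (R : realType) (x : R) : R := (expR x - expR (- x)) / 2.

Definition cosh (R : realType) (x : R) : R := (expR x + expR (- x)) / 2.

(* The infinite sums are limits of partial sums in R; the limits exist for all
   arguments, by is_cvg_f0, is_cvg_f1 and is_cvg_besselI. *)

Definition f0 (R : realType) (d : R) : R :=
  limn (fun n => \sum_(1 <= l < n) (d ^+ (2 * l + 1) / (l`!%:R) ^+ 2)).

Definition f1 (R : realType) (d : R) : R :=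
  limn (fun n => \sum_(1 <= h < n) (d ^+ (2 * h) / (h`!%:R * (h - 1)`!%:R))).

(* Modified Bessel function of the first kind I_a(z), of integer order a. *)
Definition besselI (R : realType) (a : nat) (z : R) : R :=
  limn (fun n => \sum_(0 <= m < n)
    ((z / 2) ^+ (2 * m + a) / (m`!%:R * (m + a)`!%:R))).

Lemma is_cvg_le_expR (R : realType) (c y : R) (u : nat -> R) :
  (forall n, `|u n| <= c * (y ^+ n / n`!%:R)) -> cvgn (series u).
Proof.
move=> u_le; apply: normed_cvg.
have cv := @is_cvg_seriesZ _ _ c (is_cvg_series_exp_coeff y).
apply: series_le_cvg cv => n /=; first exact: normr_ge0.
- exact: le_trans (u_le n).
- exact: u_le.
Qed.

Lemma fact_inv_le1 (R : realType) (n : nat) : n`!%:R^-1 <= 1 :> R.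
Proof. by rewrite invf_le1 ?ltr0n ?fact_gt0 // ler1n fact_gt0. Qed.

Lemma is_cvg_besselI (R : realType) (a : nat) (z : R) :
  cvgn (fun n => \sum_(0 <= m < n)
    ((z / 2) ^+ (2 * m + a) / (m`!%:R * (m + a)`!%:R))).
Proof.
apply: (@is_cvg_le_expR _ (`|z / 2| ^+ a) (`|z / 2| ^+ 2)) => n.
rewrite normrM normrX [X in _ * X <= _]ger0_norm; last first.
  by rewrite invr_ge0 mulr_ge0.
rewrite exprD exprM invfM mulrA (mulrC _ (`|_| ^+ a)) -mulrA -mulrA.
rewrite ler_wpM2l ?exprn_ge0// ler_wpM2l ?exprn_ge0//.
by rewrite -[leRHS]mulr1 ler_wpM2l ?invr_ge0// fact_inv_le1.
Qed.

Lemma is_cvg_f0 (R : realType) (d : R) :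
  cvgn (fun n => \sum_(1 <= l < n) (d ^+ (2 * l + 1) / (l`!%:R) ^+ 2)).
Proof.
rewrite (is_cvg_series_restrict 1 (fun l => d ^+ (2 * l + 1) / (l`!%:R) ^+ 2)).
apply: (@is_cvg_le_expR _ `|d| (`|d| ^+ 2)) => n.
rewrite normrM normrX [X in _ * X <= _]ger0_norm; last first.
  by rewrite invr_ge0 exprn_ge0.
rewrite exprD exprM expr1 expr2 invfM (mulrC _ `|d|) -mulrA.
rewrite ler_wpM2l// ler_wpM2l ?exprn_ge0//.
by rewrite -[leRHS]mulr1 ler_wpM2l ?invr_ge0// fact_inv_le1.
Qed.

Lemma is_cvg_f1 (R : realType) (d : R) :
  cvgn (fun n => \sum_(1 <= h < n) (d ^+ (2 * h) / (h`!%:R * (h - 1)`!%:R))).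
Proof.
rewrite (is_cvg_series_restrict 1
  (fun h => d ^+ (2 * h) / (h`!%:R * (h - 1)`!%:R))).
apply: (@is_cvg_le_expR _ 1 (`|d| ^+ 2)) => n.
rewrite normrM normrX [X in _ * X <= _]ger0_norm; last first.
  by rewrite invr_ge0 mulr_ge0.
rewrite exprM mul1r invfM ler_wpM2l ?exprn_ge0//.
by rewrite -[leRHS]mulr1 ler_wpM2l ?invr_ge0// fact_inv_le1.
Qed.

(* Main.v *)
Require Import Defs.
From mathcomp Require Import all_boot all_order all_algebra.
From mathcomp Require Import all_classical all_reals all_analysis.
From mathcomp Require Import zify ring lra.

Set Implicit Arguments.
Unset Strict Implicit.
Unset Printing Implicit Defensive.

Import Order.TTheory GRing.Theory Num.Theory.
Import numFieldNormedType.Exports.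

Local Open Scope ring_scope.

(** Write [g = d / N].  Since [B = B2 *m B1] with [B1] and [B2] involutions, the
matrices [B] and [B2] satisfy the dihedral relations, so every word in [B] and
[g *: B1] is a power of [g] times a rotation [B ^+ k] or a reflection
[B ^+ k *m B2].  Multiplying the [n]-th power of [B + g *: B1] by [B ^+ n] makes
all exponents of [B] even and nonnegative.  Adding one more factor then acts on
the coefficients by Pascal's rule, which gives the products of two binomial
coefficients by induction on [n] ([expr_rotation_reflection], valid in any
ring).  For [n = 2 * N] the prefactor disappears, because [B] is the permutation
matrix of a single cycle of length [2 * N] ([B_order]).

The coefficient of a rotation is [eta], except for the word without any [B1],
which gives the identity matrix.  The coefficient of a reflection is [zeta] plus
the term [g] of the words with exactly one [B1].  The latter terms add up to
[g] times the sum of all [B ^+ (2 * j) *m B2], that is to [2 * g] times [Phat]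
([sum_B_even]): summing over the even powers of a cycle amounts to adding the
plain sum of all powers, which is the all-ones matrix, and their alternating
sum, which is the all-ones matrix conjugated by the signs of [vminus].

The expansion holds in any ring, hence also for real numbers.  With all
generators equal to [1], and then with [B] and [B2] sent to [-1], it evaluates
[(1 + g) ^+ (2 * N)] and [(1 - g) ^+ (2 * N)] in terms of the sums of [zeta] and
of [eta] ([sum_zetaE], [sum_etaE]).  These sums are therefore the odd and the even
part of [(1 + g) ^+ (2 * N)], without their lowest terms, and are compared with
[sinh (2 * d)] and [cosh (2 * d)] through the addition formulas
([binomial_le_cosh_sinh]).  The correction terms [f0 d] and [f1 d] are
nonnegative. *)

(** * Powers of a rotation plus a multiple of a reflection *)

(** The coefficient of a rotation comes from the words with a positive even
number [2 * h.+1] of reflections: these cut a word into [h.+2] blocks of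
rotations counted positively and [h.+1] blocks counted negatively, and the two
binomial coefficients count the possible sizes of these blocks.  Here [j + k.+1] is the
length of the word. *)
Definition evenCoef (A : pzRingType) (g : A) (j k : nat) : A :=
  \sum_(h < j) g ^+ (2 * h.+1) *+ ('C(j, h.+1) * 'C(k, h)).

(** The same count for an odd number [2 * l + 1] of reflections, where both kinds
of blocks are [l.+1] in number. *)
Definition oddCoef (A : pzRingType) (g : A) (j k : nat) : A :=
  \sum_(l < j.+1) g ^+ (2 * l + 1) *+ ('C(j, l) * 'C(k, l)).

Section Expansion.
Variables (A : pzRingType) (g b s t : A).

Lemma evenCoefS j k :
  evenCoef g j.+1 k = evenCoef g j k + g * oddCoef g j k.
Proof.
rewrite /evenCoef /oddCoef mulr_sumr.
under eq_bigr do rewrite binS mulnDl mulrnDr.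
rewrite big_split /= big_ord_recr /= bin_small // mul0n mulr0n addr0.
congr (_ + _); apply: eq_bigr => l _.
by rewrite mulrnAr -exprS; congr (_ ^+ _ *+ _); lia.
Qed.

Lemma oddCoefS j k :
  oddCoef g j k.+1 = oddCoef g j k + g * evenCoef g j k.
Proof.
rewrite /evenCoef /oddCoef mulr_sumr !big_ord_recl !bin0 -addrA.
congr (_ + _); rewrite -big_split; apply: eq_bigr => l _ /=.
rewrite mulrnAr -exprS /bump /= add1n binS mulnDr mulrnDr.
by congr (_ + _ ^+ _ *+ _); lia.
Qed.

Lemma oddCoef0 j : oddCoef g j 0 = g.
Proof.
rewrite /oddCoef big_ord_recl big1 ?addr0 ?bin0 //= => l _.
by rewrite muln0 mulr0n.
Qed.

Hypotheses (gb : GRing.comm g b) (gs : GRing.comm g s).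
Hypotheses (ss : s * s = 1) (tt : t * t = 1) (b_def : b = t * s).

(** Since [b * s = t] and [b * t * b = t], multiplying by [b] on the left and by
[b + g * s] on the right sends [b ^+ (2 * j)] to
[b ^+ (2 * j.+1) + g * (b ^+ (2 * j) * t)], and [b ^+ (2 * j) * t] to
[b ^+ (2 * j) * t + g * b ^+ (2 * j.+1)].  On coefficients this is exactly
[evenCoefS] and [oddCoefS]; the powers of [b] alone start each family of
reflections with [oddCoef0]. *)
Lemma expr_rotation_reflection n :
  b ^+ n * (b + g * s) ^+ n
    = b ^+ (2 * n) + \sum_(j < n) evenCoef g j (n.-1 - j) * b ^+ (2 * j)
      + \sum_(j < n) oddCoef g j (n.-1 - j) * (b ^+ (2 * j) * t).
Proof.
have bs : b * s = t by rewrite b_def -mulrA ss mulr1.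
have gt : g * t = t * g by rewrite -bs; exact/commrM.
have ts : t * s = b by [].
have btb : b * t * b = t by rewrite {2}b_def mulrA -(mulrA b) tt mulr1 bs.
have gX k : g * b ^+ k = b ^+ k * g by exact/commrX.
have evenb j k : b * evenCoef g j k = evenCoef g j k * b.
  apply/commr_sum => i _; apply/commrMn/commrX; exact: commr_sym.
have oddb j k : b * oddCoef g j k = oddCoef g j k * b.
  apply/commr_sum => i _; apply/commrMn/commrX; exact: commr_sym.
have eveng j k : evenCoef g j k * g = g * evenCoef g j k.
  by apply/esym/commr_sum => i _; apply/commrMn/commrX.
have oddg j k : oddCoef g j k * g = g * oddCoef g j k.
  by apply/esym/commr_sum => i _; apply/commrMn/commrX.
have step1 k : b * b ^+ (2 * k) * (b + g * s)
    = b ^+ (2 * k.+1) + g * (b ^+ (2 * k) * t).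
  rewrite mulrDr -exprS -exprSr; congr (b ^+ _ + _); first by lia.
  by rewrite !mulrA -gX -!mulrA exprSr -mulrA bs.
have step2 k : b * (b ^+ (2 * k) * t) * (b + g * s)
    = b ^+ (2 * k) * t + g * b ^+ (2 * k.+1).
  rewrite mulrDr; congr (_ + _).
    by rewrite mulrA -exprS exprSr -!mulrA (mulrA b) btb.
  by rewrite (mulrA b) -exprS -mulrA (mulrA t) -gt -(mulrA g) ts mulrA -gX
    -mulrA -exprSr mulnS.
elim: n => [|n IH]; first by rewrite !big_ord0 !addr0 mulr1.
(* Only [step1] and [step2] may expand the last factor. *)
move: (b + g * s) step1 step2 IH => M step1 step2 IH.
have -> : b ^+ n.+1 * M ^+ n.+1 = b * (b ^+ n * M ^+ n) * M.
  by rewrite exprS exprSr !mulrA.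
rewrite IH !mulrDr !mulrDl step1 !mulr_sumr !mulr_suml.
under eq_bigr => j _.
  rewrite mulrA evenb -(mulrA _ b) -(mulrA (evenCoef _ _ _)) step1 mulrDr.
  rewrite (mulrA _ g) eveng.
  over.
under [in X in _ + X]eq_bigr => j _.
  rewrite mulrA oddb -(mulrA _ b) -(mulrA (oddCoef _ _ _)) step2 mulrDr.
  rewrite (mulrA _ g) oddg.
  over.
rewrite !big_split /=.
have -> : \sum_(j < n.+1) evenCoef g j (n - j) * b ^+ (2 * j)
    = \sum_(j < n) evenCoef g j (n.-1 - j) * b ^+ (2 * j.+1)
      + \sum_(j < n) g * oddCoef g j (n.-1 - j) * b ^+ (2 * j.+1).
  rewrite big_ord_recl /evenCoef big_ord0 mul0r add0r -big_split.
  apply: eq_bigr => j _ /=; rewrite -mulrDl -evenCoefS /bump /=.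
  by congr (evenCoef _ _ _ * _); lia.
have -> : \sum_(j < n.+1) oddCoef g j (n - j) * (b ^+ (2 * j) * t)
    = \sum_(j < n) oddCoef g j (n.-1 - j) * (b ^+ (2 * j) * t)
      + \sum_(j < n) g * evenCoef g j (n.-1 - j) * (b ^+ (2 * j) * t)
      + g * (b ^+ (2 * n) * t).
  rewrite big_ord_recr /= subnn oddCoef0 -big_split; congr (_ + _).
  apply: eq_bigr => j _ /=; rewrite -mulrDl -oddCoefS.
  by congr (oddCoef _ _ _ * _); have := ltn_ord j; lia.
by rewrite [LHS](AC (2*2*2) (1*(3*6)*(5*4*2))%AC).
Qed.

End Expansion.

Lemma rmorph_evenCoef (A A' : pzRingType) (f : {rmorphism A -> A'}) g j k :
  f (evenCoef g j k) = evenCoef (f g) j k.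
Proof.
by rewrite rmorph_sum; apply: eq_bigr => h _; rewrite rmorphMn rmorphXn.
Qed.

Lemma rmorph_oddCoef (A A' : pzRingType) (f : {rmorphism A -> A'}) g j k :
  f (oddCoef g j k) = oddCoef (f g) j k.
Proof.
by rewrite rmorph_sum; apply: eq_bigr => h _; rewrite rmorphMn rmorphXn.
Qed.

(** * Matrices of functions on indices *)

Section FunMatrix.
Variables (R : realType) (n : nat).

(** Functions on [nat] rather than on ordinals, so that the index maps of [B1] and
[B2] can be composed and iterated without bounds. *)
Definition funmx (f : nat -> nat) : 'M[R]_n :=
  \matrix_(i, k) (k == f i :> nat)%:R.

Definition stable (f : nat -> nat) := forall i, (i < n)%N -> (f i < n)%N.

Lemma mul_funmx f g : stable f -> funmx f *m funmx g = funmx (g \o f).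
Proof.
move=> fn; apply/matrixP => i k; rewrite !mxE.
rewrite (bigD1 (Ordinal (fn i (ltn_ord i)))) //= big1 ?addr0 => [|j jfi].
  by rewrite !mxE eqxx mul1r.
by rewrite !mxE [_ == _]negbTE ?mul0r.
Qed.

Lemma funmx_exp f m : stable f -> funmx f ^+ m = funmx (iter m f).
Proof.
move=> fn; elim: m => [|m IH].
  by apply/matrixP => i k; rewrite !mxE eq_sym.
rewrite exprS IH [LHS]mul_funmx //.
by apply/matrixP => i k; rewrite !mxE /= -iterSr.
Qed.

Lemma funmx_id f : (forall i, (i < n)%N -> f i = i) -> funmx f = 1%:M.
Proof. by move=> fi; apply/matrixP => i k; rewrite !mxE fi // eq_sym. Qed.

Lemma mulmx_funmx_inv f m (X : 'M[R]_(m, n)) :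
  stable f -> (forall i, (i < n)%N -> f (f i) = i) ->
  forall i (k k' : 'I_n), k' = f k :> nat -> (X *m funmx f) i k = X i k'.
Proof.
move=> fn fK i k k' k'E; rewrite !mxE (bigD1 k') //= big1 ?addr0 => [|j jk'].
  by rewrite mxE k'E fK // eqxx mulr1.
rewrite mxE [_ == _]negbTE ?mulr0 //; apply: contraNN jk' => /eqP kE.
by apply/eqP/val_inj; rewrite /= k'E kE fK.
Qed.

End FunMatrix.

(** Adding the alternating sum doubles the terms of even index and cancels the
others, while by periodicity the indices [2 * j] run twice through the even
indices of a period. *)
Lemma sum_even_periodic (A : pzRingType) (V : lmodType A) (N : nat)
    (F : nat -> V) : (forall j, F (2 * N + j)%N = F j) ->
  \sum_(j < 2 * N) F (2 * j)%N
    = \sum_(m < 2 * N) (F m + (-1) ^+ m *: F m).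
Proof.
move=> per.
rewrite -(big_mkord xpredT (fun j => F (2 * j)%N)).
rewrite -(big_mkord xpredT (fun m => F m + (-1) ^+ m *: F m)).
rewrite (big_cat_nat (n := N)) ?leq_pmull //= -{2}[N]add0n big_addn.
rewrite mul2n -addnn addnK.
under [X in _ + X = _]eq_bigr do rewrite addnC mulnDr per.
rewrite -big_split /= addnn; elim: (N) => [|m IH]; first by rewrite !big_nil.
rewrite doubleS !big_nat_recr //= -IH -addrA; congr (_ + _).
rewrite exprS -mul2n exprM sqrrN !expr1n mulr1 scale1r scaleN1r subrr.
by rewrite addr0.
Qed.

(** * The cycle of length 2N *)

Section Cycle.
Variables (R : realType) (N : nat).
Let n := (2 * N)%N.
Let B := B R N.

(** The rotation moves odd indices up by [2] and even indices down by [2], turning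
around at both ends.  The cycle thus runs through [1, 3, ..., n.-1] and then
through [n.-2, ..., 2, 0]; this is the rank of an index in that list. *)
Definition cyclePos (i : nat) : nat := (if odd i then i./2 else n.-1 - i./2)%N.

Definition rot1 (i : nat) : nat := swap1 (swap2 N i).

Lemma swap1P i :
  (odd i /\ swap1 i = i.-1 \/ ~~ odd i /\ swap1 i = i.+1)%N.
Proof.
by rewrite /swap1; case: ifP => ?; [left | right]; split=> //; lia.
Qed.

Lemma swap2P i : (i < n)%N ->
  [\/ (i = 0 \/ i = n.-1) /\ swap2 N i = i,
      [/\ odd i, i.+1 < n & swap2 N i = i.+1]
    | [/\ ~~ odd i, 0 < i & swap2 N i = i.-1]]%N.
Proof.
rewrite /n /swap2; case: ifP => [?|].
  by move=> *; apply: Or31; split=> //; lia.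
by case: ifP => ? ? ?; [apply: Or32 | apply: Or33]; split=> //; lia.
Qed.

Lemma swap1_stable : stable n swap1.
Proof. by rewrite /n => i; rewrite /swap1; case: ifP; lia. Qed.

Lemma swap2_stable : stable n (swap2 N).
Proof. by rewrite /n => i; rewrite /swap2; repeat (case: ifP => ?); lia. Qed.

Lemma swap1K i : swap1 (swap1 i) = i.
Proof.
by rewrite {2}/swap1; case: ifP => ?; rewrite /swap1; case: ifP => ?; lia.
Qed.

Lemma swap2K i : (i < n)%N -> swap2 N (swap2 N i) = i.
Proof.
rewrite /n {2}/swap2 => ?.
by repeat (case: ifP => ?); rewrite /swap2; repeat (case: ifP => ?); lia.
Qed.

Lemma rot1_stable : stable n rot1.
Proof. by move=> i /swap2_stable /swap1_stable. Qed.

Lemma cyclePos_lt i : (i < n)%N -> (cyclePos i < n)%N.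
Proof. by rewrite /n /cyclePos => ?; case: ifP; rewrite /n; lia. Qed.

Lemma cyclePos_inj i k : (i < n)%N -> (k < n)%N ->
  cyclePos i = cyclePos k -> i = k.
Proof. by rewrite /cyclePos /n => ? ?; repeat (case: ifP => ?); lia. Qed.

Lemma cyclePos_rot1 i : (i < n)%N ->
  cyclePos (rot1 i) = (if (cyclePos i).+1 == n then 0 else (cyclePos i).+1)%N.
Proof.
rewrite /n /rot1 => i_n.
have := swap2P i_n; rewrite /n.
move: (swap2 N i) => k kE.
have := swap1P k.
move: (swap1 k) => l lE; rewrite /cyclePos /n.
by case: kE => [[? ?]|[? ? ?]|[? ? ?]]; case: lE => -[? ->];
  case: (boolP (odd i)) => ?; repeat (case: ifP => ?); lia.
Qed.

Lemma iter_rot1_lt m i : (i < n)%N -> (iter m rot1 i < n)%N.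
Proof. by move=> i_n; elim: m => //= m; exact: rot1_stable. Qed.

Lemma cyclePos_iter m i : (i < n)%N ->
  cyclePos (iter m rot1 i) = ((cyclePos i + m) %% n)%N.
Proof.
move=> i_n; have n0 : (0 < n)%N by exact: leq_ltn_trans i_n.
elim: m => [|m IH]; first by rewrite addn0 modn_small // cyclePos_lt.
rewrite /= cyclePos_rot1 ?iter_rot1_lt // IH addnS.
have -> : ((cyclePos i + m).+1 %% n = ((cyclePos i + m) %% n).+1 %% n)%N.
  by rewrite -addn1 -modnDml addn1.
case: eqP => [->|/eqP ne]; first by rewrite modnn.
by rewrite [RHS]modn_small // ltn_neqAle ne ltn_pmod.
Qed.

Lemma iter_rot1_eq m i k : (i < n)%N -> (k < n)%N ->
  (k == iter m rot1 i) = ((cyclePos i + m) %% n == cyclePos k)%N.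
Proof.
move=> i_n k_n; rewrite -cyclePos_iter //; apply/eqP/eqP => [->//|].
by move/cyclePos_inj => <- //; exact: iter_rot1_lt.
Qed.

Lemma B_expE m : B ^+ m = funmx R n (iter m rot1).
Proof.
rewrite /B /Defs.B -funmx_exp; last exact: rot1_stable.
by congr (_ ^+ _); rewrite [LHS]mul_funmx //; exact: swap2_stable.
Qed.

Lemma B_order : B ^+ n = 1%:M.
Proof.
rewrite B_expE; apply: funmx_id => i i_n; apply/esym/eqP.
by rewrite iter_rot1_eq // modnDr modn_small ?cyclePos_lt.
Qed.

Lemma B1_involutive : B1 R N *m B1 R N = 1%:M.
Proof.
rewrite [LHS](mul_funmx R swap1 swap1_stable).
by apply: funmx_id => i _ /=; exact: swap1K.
Qed.

Lemma B2_involutive : B2 R N *m B2 R N = 1%:M.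
Proof.
rewrite [LHS](mul_funmx R _ swap2_stable).
by apply: funmx_id => i i_n /=; exact: swap2K.
Qed.

(** A cycle takes each index to each index for exactly one exponent below its
length. *)
Lemma sum_B_exp : \sum_(m < n) B ^+ m = evec R N *m (evec R N)^T.
Proof.
apply/matrixP => i k; rewrite summxE !mxE big_ord1 !mxE mulr1.
have i_n := cyclePos_lt (ltn_ord i); have k_n := cyclePos_lt (ltn_ord k).
set a := cyclePos i in i_n; set c := cyclePos k in k_n.
(* The only exponent [m] taking [i] to [k] is [c - a] modulo [n]. *)
have m_n : ((if a <= c then c - a else c + n - a) < n)%N by case: ifP; lia.
have eqm m : (m < n)%N ->
    ((a + m) %% n == c)%N = (m == if a <= c then c - a else c + n - a)%N.
  move=> mn; have -> : ((a + m) %% n = if a + m < n then a + m else a + m - n)%N.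
    case: ltnP => nam; first by rewrite modn_small.
    by rewrite -[in LHS](subnK nam) modnDr modn_small //; lia.
  by repeat (case: ifP => ?); lia.
rewrite (bigD1 (Ordinal m_n)) //= big1 ?addr0 => [|m mE].
  by rewrite B_expE !mxE iter_rot1_eq // eqm // eqxx.
by rewrite B_expE !mxE iter_rot1_eq // eqm // [_ == _]negbTE.
Qed.

Let v (i : nat) : R := if ((i %% 4 == 0) || (i %% 4 == 3))%N then 1 else -1.

Lemma v_swap1 i : v (swap1 i) = - v i.
Proof.
case: (swap1P i) => -[? ->];
  by rewrite /v; repeat (case: ifP => ?); rewrite ?opprK //; lia.
Qed.

Lemma v_swap2 i : ~~ odd N -> (i < n)%N -> v (swap2 N i) = v i.
Proof.
move=> Ne /swap2P; rewrite /n => -[[? ->]|[? ? ->]|[? ? ->]] //;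
  by rewrite /v; repeat (case: ifP => ?); rewrite ?opprK //; lia.
Qed.

Lemma v_iter m i : ~~ odd N -> (i < n)%N ->
  v (iter m rot1 i) = (-1) ^+ m * v i.
Proof.
move=> Ne i_n; elim: m => [|m IH]; first by rewrite mul1r.
by rewrite /= v_swap1 v_swap2 ?iter_rot1_lt // IH exprS mulN1r mulNr.
Qed.

Lemma v_sqr i : v i * v i = 1.
Proof. by rewrite /v; case: ifP; rewrite ?mulrNN mulr1. Qed.

(** The rotation changes the sign of [vminus], so a nonzero entry of [B ^+ m] at
[(i, k)] has [(-1) ^+ m = v i * v k]. *)
Lemma sum_signed_B_exp : ~~ odd N ->
  \sum_(m < n) (-1) ^+ m *: B ^+ m = vminus R N *m (vminus R N)^T.
Proof.
move=> Ne; apply/matrixP => i k.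
rewrite summxE !mxE big_ord1 !mxE -/(v i) -/(v k).
have := congr1 (fun X : 'M[R]_n => v i * v k * X i k) sum_B_exp.
rewrite summxE !mxE big_ord1 !mxE !mulr1 => <-; rewrite mulr_sumr.
apply: eq_bigr => m _; rewrite B_expE !mxE.
case: eqP => [->|]; last by rewrite !mulr0.
by rewrite v_iter // !mulr1 mulrCA v_sqr mulr1.
Qed.

(** The factor [B2] is absorbed because it fixes both [evec] and [vminus]. *)
Lemma sum_B_even : ~~ odd N ->
  \sum_(j < n) B ^+ (2 * j) *m B2 R N = 2 *: Phat R N.
Proof.
move=> Ne.
have -> : \sum_(j < n) B ^+ (2 * j) *m B2 R N
    = (evec R N *m (evec R N)^T + vminus R N *m (vminus R N)^T) *m B2 R N.
  rewrite -mulmx_suml -sum_B_exp -sum_signed_B_exp // -big_split /=.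
  congr (_ *m _).
  apply: (@sum_even_periodic R 'M[R]_n N (fun j => B ^+ j)) => j.
  by rewrite exprD B_order mul1r.
rewrite /Phat scalerA divff ?pnatr_eq0 // scale1r.
apply/matrixP => i k.
pose k' := Ordinal (swap2_stable (ltn_ord k)).
rewrite (mulmx_funmx_inv _ swap2_stable swap2K _ (k' := k')) //.
by rewrite !mxE !big_ord1 !mxE -!/(v _) /= v_swap2.
Qed.

End Cycle.

(** * Hyperbolic functions *)

Section Hyperbolic.
Variable R : realType.
Implicit Types (g x y : R) (n : nat).

Lemma cosh_ge1 x : 1 <= cosh x.
Proof. rewrite /cosh; have := expR_ge1Dx x; have := expR_ge1Dx (- x); lra. Qed.

Lemma sinhD x y : sinh (x + y) = sinh x * cosh y + cosh x * sinh y.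
Proof. by rewrite /sinh /cosh opprD !expRD; field. Qed.

Lemma coshD x y : cosh (x + y) = cosh x * cosh y + sinh x * sinh y.
Proof. by rewrite /sinh /cosh opprD !expRD; field. Qed.

Lemma sinh_ge_id x : 0 <= x -> x <= sinh x.
Proof.
move=> x0.
pose f y := (expR y - expR (- y)) / 2 - y.
have df y : is_derive y (1 : R) f (cosh y - 1).
  rewrite /f /cosh; apply: is_derive_eq.
  by rewrite /GRing.scale /=; field.
have : f 0 <= f x.
  apply: (@ger0_derive1_le_cc _ f 0 x); rewrite ?in_itv/= ?lexx ?x0//.
  - move=> y _; rewrite derive1E derive_val subr_ge0; exact: cosh_ge1.
  - by apply: derivable_within_continuous => y _.
by rewrite /f oppr0 subrr mul0r addr0 subr_ge0.
Qed.

Lemma sinh_ge0 x : 0 <= x -> 0 <= sinh x.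
Proof. by move=> x0; apply: (le_trans x0); exact: sinh_ge_id. Qed.

(** Both even parts and odd parts satisfy an addition recurrence from [n] to
[n.+1], with multipliers [(1, g)] for the powers and [(cosh g, sinh g)] for the
hyperbolic functions; the claim follows from [1 <= cosh g] and [g <= sinh g]. *)
Lemma binomial_le_cosh_sinh g n : 0 <= g ->
  ((1 + g) ^+ n + (1 - g) ^+ n) / 2 <= cosh (n%:R * g) /\
  ((1 + g) ^+ n - (1 - g) ^+ n) / 2 <= sinh (n%:R * g).
Proof.
move=> g0; elim: n => [|n [IHc IHs]].
  by rewrite /cosh /sinh mul0r oppr0 expR0 !expr0 subrr mul0r; split.
have n0 : 0 <= n%:R * g by rewrite mulr_ge0.
have -> : n.+1%:R * g = n%:R * g + g by rewrite -natr1 mulrDl mul1r.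
rewrite sinhD coshD !exprSr.
have := sinh_ge_id g0; have := cosh_ge1 g.
have := cosh_ge1 (n%:R * g); have := sinh_ge0 n0.
move: IHc IHs; set p := (1 + g) ^+ n; set q := (1 - g) ^+ n.
move: (cosh g) (sinh g) (cosh _) (sinh _) => cg sg cn sn *; split.
  have : (p * (1 + g) + q * (1 - g)) / 2 = (p + q) / 2 + g * ((p - q) / 2)
    by field.
  nra.
have : (p * (1 + g) - q * (1 - g)) / 2 = (p - q) / 2 + g * ((p + q) / 2)
  by field.
nra.
Qed.

End Hyperbolic.

(** * The coefficients and their sums *)

Section Coefficients.
Variable R : realType.
Implicit Types (g d : R) (n N : nat).

Lemma expr1D_sum_coef g n :
  (1 + g) ^+ n = 1 + \sum_(j < n) evenCoef g j (n.-1 - j)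
                   + \sum_(j < n) oddCoef g j (n.-1 - j).
Proof.
have := @expr_rotation_reflection _ g 1 1 1 (mulrC _ _) (mulrC _ _)
  (mulr1 _) (mulr1 _) (esym (mulr1 _)) n.
rewrite !mulr1 !expr1n mul1r => ->; congr (_ + _ + _);
  by apply: eq_bigr => j _; rewrite !expr1n ?mulr1.
Qed.

(** The relations [s * s = 1], [t * t = 1] and [b = t * s] also hold for [s = 1]
and [b = t = -1], which separates the two families of coefficients. *)
Lemma expr1B_sum_coef g n :
  (1 - g) ^+ n = 1 + \sum_(j < n) evenCoef g j (n.-1 - j)
                   - \sum_(j < n) oddCoef g j (n.-1 - j).
Proof.
have N11 : -1 * -1 = 1 :> R by rewrite mulrNN mulr1.
have := @expr_rotation_reflection _ g (-1) 1 (-1) (mulrC _ _) (mulrC _ _)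
  (mulr1 _) N11 (esym (mulr1 _)) n.
have N1X k : (-1) ^+ (2 * k) = 1 :> R by rewrite exprM sqrrN !expr1n.
rewrite -exprMn mulrDr N11 mulr1 mulN1r N1X => ->.
congr (_ + _ + _); first by apply: eq_bigr => j _; rewrite N1X mulr1.
by rewrite -sumrN; apply: eq_bigr => j _; rewrite N1X mul1r mulrN1.
Qed.

(** The upper bound of the sum in [eta] only drops terms in which a binomial
coefficient vanishes. *)
Lemma etaE N d j : (j < 2 * N)%N ->
  eta N d j = evenCoef (d / N%:R) j ((2 * N).-1 - j).
Proof.
move=> jN; rewrite /eta /evenCoef big_add1 /= -(big_mkord xpredT
  (fun h => (d / N%:R) ^+ (2 * h.+1) *+ ('C(j, h.+1) * 'C((2 * N).-1 - j, h)))).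
rewrite [RHS](big_cat_nat (n := minn j (2 * N - j))) ?geq_minl //=.
rewrite [X in _ = _ + X]big_nat_cond [X in _ = _ + X]big1 ?addr0; last first.
  move=> h; rewrite andbT => hlt; rewrite (@bin_small ((2 * N).-1 - j)) ?muln0 //.
  lia.
apply: eq_bigr => h _; rewrite -mulrA -natrM mulr_natr subn1 /=.
by congr (_ *+ (_ * 'C(_, _))); lia.
Qed.

(** The term [d / N%:R], absent from [zeta], is the one of index [l = 0]. *)
Lemma zetaE N d j : (j < 2 * N)%N ->
  zeta N d j + d / N%:R = oddCoef (d / N%:R) j ((2 * N).-1 - j).
Proof.
move=> jN; rewrite /zeta /oddCoef -(big_mkord xpredT
  (fun l => (d / N%:R) ^+ (2 * l + 1) *+ ('C(j, l) * 'C((2 * N).-1 - j, l)))).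
rewrite [RHS](big_cat_nat (n := (minn j (2 * N - j - 1)).+1)) ?ltnS ?geq_minl //=.
rewrite [X in _ = _ + X]big_nat_cond [X in _ = _ + X]big1 ?addr0; last first.
  move=> h; rewrite andbT => hlt; rewrite (@bin_small ((2 * N).-1 - j)) ?muln0 //.
  lia.
rewrite [RHS]big_ltn // !bin0 mulr1n addrC; congr (_ + _).
apply: eq_bigr => h _; rewrite -mulrA -natrM mulr_natr.
by congr (_ *+ (_ * 'C(_, _))); lia.
Qed.

End Coefficients.

Lemma sum_eta_from0 (R : realType) (N : nat) (d : R) (V : lmodType R)
    (F : nat -> V) :
  \sum_(1 <= j < 2 * N) eta N d j *: F j
    = \sum_(0 <= j < 2 * N) eta N d j *: F j.
Proof.
have eta0 : eta N d 0 = 0 by rewrite /eta min0n big_geq.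
case: (2 * N)%N => [|n]; first by rewrite !big_geq.
by rewrite [RHS]big_ltn // eta0 scale0r add0r.
Qed.

Lemma sum_zetaE (R : realType) (N : nat) (d : R) : (0 < N)%N ->
  \sum_(0 <= j < 2 * N) zeta N d j
    = ((1 + d / N%:R) ^+ (2 * N) - (1 - d / N%:R) ^+ (2 * N)) / 2 - 2 * d.
Proof.
move=> N0; rewrite expr1D_sum_coef expr1B_sum_coef big_mkord.
have -> : \sum_(j < 2 * N) oddCoef (d / N%:R) j ((2 * N).-1 - j)
    = \sum_(j < 2 * N) zeta N d j + 2 * d.
  under eq_bigr => j _ do rewrite -zetaE //.
  rewrite big_split /= sumr_const card_ord -(mulr_natl (d / N%:R)) natrM.
  congr (_ + _).
  by field; rewrite pnatr_eq0 -lt0n.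
by field.
Qed.

Lemma sum_etaE (R : realType) (N : nat) (d : R) : (0 < N)%N ->
  \sum_(1 <= j < 2 * N) eta N d j
    = ((1 + d / N%:R) ^+ (2 * N) + (1 - d / N%:R) ^+ (2 * N)) / 2 - 1.
Proof.
move=> N0; rewrite expr1D_sum_coef expr1B_sum_coef.
under eq_bigr do rewrite -[eta _ _ _]mulr1.
rewrite (@sum_eta_from0 _ _ _ R^o (fun=> 1)).
under eq_bigr do rewrite [_ *: _]mulr1.
rewrite big_mkord; under eq_bigr => j _ do rewrite etaE //.
by field.
Qed.

(** * Bessel series *)

Lemma f0_besselI (R : realType) (d : R) : f0 d = d * (besselI 0 (2 * d) - 1).
Proof.
have dE : 2 * d / 2 = d by field.
apply: (cvg_lim (@Rhausdorff R)); rewrite -cvg_shiftS.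
have cv := @is_cvg_besselI R 0 (2 * d); rewrite -cvg_shiftS in cv.
apply: cvg_trans (cvgM (cvg_cst d) (cvgB cv (cvg_cst (1 : R)))).
apply: near_eq_cvg; near=> n => /=.
rewrite !fctE big_ltn // muln0 !addn0 expr0 fact0 mulr1 divr1.
rewrite (addrC 1) addrK mulr_sumr dE.
apply: eq_bigr => l _.
by rewrite !addn0 exprD expr1 expr2 mulrA (mulrC d).
Unshelve. all: by end_near. Qed.

Lemma f1_besselI (R : realType) (d : R) : f1 d = d * besselI 1 (2 * d).
Proof.
have dE : 2 * d / 2 = d by field.
apply: (cvg_lim (@Rhausdorff R)); rewrite -cvg_shiftS.
have cv := @is_cvg_besselI R 1 (2 * d).
apply: cvg_trans (cvgM (cvg_cst d) cv).
apply: near_eq_cvg; near=> n => /=.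
rewrite big_add1 /= mulr_sumr dE.
apply: eq_bigr => h _.
rewrite subn1 /= !addn1 mulrA -exprS mulnS (mulrC (h`!%:R)).
by congr (d ^+ _ / _).
Unshelve. all: by end_near. Qed.

Lemma f0_ge0 (R : realType) (d : R) : 0 <= d -> 0 <= f0 d.
Proof.
move=> d0; apply: limr_ge; first exact: is_cvg_f0.
by near=> n; apply: sumr_ge0 => l _; rewrite mulr_ge0 ?exprn_ge0 ?invr_ge0 ?exprn_ge0.
Unshelve. all: by end_near. Qed.

Lemma f1_ge0 (R : realType) (d : R) : 0 <= d -> 0 <= f1 d.
Proof.
move=> d0; apply: limr_ge; first exact: is_cvg_f1.
by near=> n; apply: sumr_ge0 => l _; rewrite mulr_ge0 ?exprn_ge0 ?invr_ge0 ?mulr_ge0.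
Unshelve. all: by end_near. Qed.

(** * Expansion of the power of the matrix *)

Lemma expr_B_add_B1 (R : realType) (N : nat) (d : R) : ~~ odd N ->
  (B R N + (d / N%:R) *: B1 R N) ^+ (2 * N)
    = 1%:M + (2 * d / N%:R) *: Phat R N
      + \sum_(0 <= j < 2 * N) zeta N d j *: (B R N ^+ (2 * j) *m B2 R N)
      + \sum_(1 <= j < 2 * N) eta N d j *: B R N ^+ (2 * j).
Proof.
move=> Ne; set g := d / N%:R.
have gC X : GRing.comm (g%:M : 'M[R]_(2 * N)) X.
  by rewrite /GRing.comm -[LHS]/(_ *m _) -[RHS]/(_ *m _) scalar_mxC.
have := expr_rotation_reflection (gC (B R N)) (gC (B1 R N))
  (B1_involutive R N) (B2_involutive R N) erefl (2 * N).
rewrite (exprM _ 2 (2 * N)) exprAC B_order expr1n mul1r.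
rewrite -[_%:M * _]/(_ *m _) mul_scalar_mx => ->.
rewrite -!addrA; congr (_ + _); rewrite addrC addrA; congr (_ + _).
  (* The terms of the words with a single [B1] make up the projection. *)
  have -> : 2 * d / N%:R = g * 2 by rewrite [RHS]mulrAC (mulrC 2).
  rewrite -scalerA -sum_B_even // scaler_sumr big_mkord -big_split /=.
  apply: eq_bigr => j _; rewrite -rmorph_oddCoef -zetaE // addrC.
  by rewrite -[_%:M * _]/(_ *m _) mul_scalar_mx scalerDl.
rewrite sum_eta_from0 big_mkord; apply: eq_bigr => j _.
rewrite -rmorph_evenCoef -etaE //.
by rewrite -[_%:M * _]/(_ *m _) mul_scalar_mx.
Qed.

Theorem theorem5p6 (R : realType) (N : nat) (d : R)
    (N_gt0 : (0 < N)%N) (N_even : ~~ odd N) (d_gt0 : 0 < d) :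
  [/\ (B R N + (d / N%:R) *: B1 R N) ^+ (2 * N)
        = 1%:M + (2 * d / N%:R) *: Phat R N
          + \sum_(0 <= j < 2 * N)
              zeta N d j *: (B R N ^+ (2 * j) *m B2 R N)
          + \sum_(1 <= j < 2 * N) eta N d j *: B R N ^+ (2 * j),
      0 <= \sum_(0 <= j < 2 * N) zeta N d j
        <= sinh (2 * d) - 2 * d + N%:R^-1 * f0 d,
      0 <= \sum_(1 <= j < 2 * N) eta N d j
        <= cosh (2 * d) - 1 + N%:R^-1 * f1 d,
      f0 d = d * (besselI 0 (2 * d) - 1)
    & f1 d = d * besselI 1 (2 * d)].
Proof.
have g_ge0 : 0 <= d / N%:R by rewrite divr_ge0 // ltW.
have [cosh_bd sinh_bd] := binomial_le_cosh_sinh (2 * N) g_ge0.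
have dE : (2 * N)%:R * (d / N%:R) = 2 * d.
  by rewrite natrM; field; rewrite pnatr_eq0 -lt0n.
rewrite dE in cosh_bd sinh_bd.
have f0_part : 0 <= N%:R^-1 * f0 d by rewrite mulr_ge0 ?invr_ge0 ?f0_ge0 // ltW.
have f1_part : 0 <= N%:R^-1 * f1 d by rewrite mulr_ge0 ?invr_ge0 ?f1_ge0 // ltW.
split; last exact: f1_besselI; last exact: f0_besselI.
- exact: expr_B_add_B1.
- apply/andP; split.
    apply: sumr_ge0 => j _; apply: sumr_ge0 => l _.
    by rewrite !mulr_ge0 // exprn_ge0.
  by rewrite sum_zetaE // -[leLHS]addr0 lerD // lerB.
apply/andP; split.
  apply: sumr_ge0 => j _; apply: sumr_ge0 => h _.
  by rewrite !mulr_ge0 // exprn_ge0.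
by rewrite sum_etaE // -[leLHS]addr0 lerD // lerB.
Qed.
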